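(* Let $S=\langle g_1,\dots,g_n\rangle$ be a numerical semigroup with smallest minimal generator $g_1$, and let $h\ge 2$ be an integer. If $|D_h|\le h+1$, then there exists an injective function $\widetilde{\psi}: D_h\to C_h$.
   Context: A numerical semigroup $S$ is a subsemigroup of $(\mathbb{N},+)$ containing $0$; $S=\langle g_1,\dots,g_n\rangle$ means that $g_1<g_2<\dots<g_n$ is its minimal set of generators, and it is assumed that $\gcd(g_1,\dots,g_n)=1$ (equivalently $\mathbb{N}\setminus S$ is finite). Put $M=S\setminus\{0\}$, $0M=S$, and for $h\ge 1$ let $hM=\{m_1+\dots+m_h : m_1,\dots,m_h\in M\}$. For $h\ge 2$ define $$D_h=\{s\in (h-1)M\setminus hM : s+g_1\in (h+1)M\},$$ $$C_h=\{s\in hM\setminus (h+1)M : s-g_1\notin (h-1)M\setminus hM\}.$$ *)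

(* Defs.v *)
From mathcomp Require Import all_boot.
From mathcomp Require Import all_classical.

Set Implicit Arguments.
Unset Strict Implicit.
Unset Printing Implicit Defensive.

Local Open Scope classical_set_scope.
Local Open Scope nat_scope.

Definition subsemigroup0 (S : set nat) : Prop :=
  S 0 /\ forall x y : nat, S x -> S y -> S (x + y).

(* The coefficients are indexed by the generators themselves. *)
Definition span (g : seq nat) : set nat :=
  [set s | exists c : nat -> nat, s = \sum_(x <- g) c x * x].

(* [g] lists the minimal set of generators of [S] in increasing order, so that
   g_i is [nth 0 g i.-1]. *)
Definition minimal_generators (S : set nat) (g : seq nat) : Prop :=
  [/\ sorted ltn g,
      span g = S
    & forall g' : seq nat,
        {subset g' <= g} -> span g' = S -> {subset g <= g'}].

(* The condition gcd = 1 excludes the empty list, whose gcd is 0 here. *)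
Definition numerical_semigroup (S : set nat) (g : seq nat) : Prop :=
  [/\ subsemigroup0 S, minimal_generators S g & \big[gcdn/0]_(x <- g) x = 1].

Definition maxideal (S : set nat) : set nat := S `\ 0.

Definition hfold (S : set nat) (h : nat) : set nat :=
  if h is 0 then S
  else [set s | exists2 m : 'I_h -> nat,
                  forall i, maxideal S (m i) & s = \sum_(i < h) m i].

Definition Dset (S : set nat) (g1 h : nat) : set nat :=
  [set s | (hfold S h.-1 `\` hfold S h) s /\ hfold S h.+1 (s + g1)].

(* The guard [g1 <= s] makes the truncated subtraction agree with the one in
   the integers: a negative [s - g1] belongs to no subset of nat. *)
Definition Cset (S : set nat) (g1 h : nat) : set nat :=
  [set s | (hfold S h `\` hfold S h.+1) s /\
           ~ (g1 <= s /\ (hfold S h.-1 `\` hfold S h) (s - g1))].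

(* Main.v *)
Require Import Defs.
From mathcomp Require Import all_boot.
From mathcomp Require Import all_classical.
From mathcomp Require Import zify.

(** Call the order of an element of [S] the largest [k] such that it lies in
    [kM].  If [s] is in [D_h], then [s + g_1] has some order [k >= h + 1], and
    subtracting [g_1] from it drops the order by more than one; so [s + g_1]
    belongs to [C_k].  Two properties of the sets [C_k] drive the proof.

    They are closed under divisors: if [x = t + m] is in [C_(k+1)], with
    [m] in [M] and [t] in [kM], then [t] is in [C_k] ([tangent_summand]).  In
    other words the [C_k] are the nonzero monomials, by degree, of a standard
    graded algebra: the associated graded ring of the semigroup ring modulo the
    initial form of the monomial of exponent [g_1].

    They obey a weak form of Macaulay's growth theorem ([shadow_size]): a set
    of at most [d] sums of [d] generators has at least as many divisors among
    the sums of [d - 1] generators.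

    The translate [D_h + g_1] is an antichain for divisibility, since
    [s' = s + m] with [s] of order [h - 1] would put [s'] in [hM].  It has at
    most [h + 1] elements, all of degree at least [h + 1].  Replacing its
    elements of top degree by equally many of their divisors, one degree lower,
    keeps it an antichain of the same size; growth applies at each step because
    the degree stays at least [h + 1].  Repeating this until every element has
    degree [h] gives [|D_h|] distinct elements of [C_h] ([antichain_descent]). *)

Local Open Scope classical_set_scope.
Local Open Scope card_scope.
Local Open Scope nat_scope.

(** * Sums of a given number of generators *)

(** The [d]-fold sumset of the entries of [A], with one coefficient recorded per
    entry, so that the multiplicity of the first generator can be split off in
    inductions on [A]. *)
Fixpoint sum_of (A : seq nat) (d x : nat) : Prop :=
  if A is a :: A' then
    exists e d' y, [/\ d = e + d', x = e * a + y & sum_of A' d' y]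
  else d = 0 /\ x = 0.

Lemma sum_of0 A : sum_of A 0 0.
Proof. by elim: A => [|a A IH] //=; exists 0, 0, 0. Qed.

Lemma sum_ofD A d d' x x' :
  sum_of A d x -> sum_of A d' x' -> sum_of A (d + d') (x + x').
Proof.
elim: A d d' x x' => [|a A IH] d d' x x' /=; first by move=> [-> ->] [-> ->].
move=> [e [f [y [-> -> hy]]]] [e' [f' [y' [-> -> hy']]]].
by exists (e + e'), (f + f'), (y + y'); split; [lia | lia | exact: IH].
Qed.

Lemma sum_of1 A a : a \in A -> sum_of A 1 a.
Proof.
elim: A => [|b A IH] //=; rewrite inE => /orP[/eqP ->|aA].
  by exists 1, 0, 0; split; [| lia | exact: sum_of0].
by exists 0, 1, a; split=> //; exact: IH.
Qed.

Lemma sum_of_deg0 A x : sum_of A 0 x -> x = 0.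
Proof.
elim: A x => [|a A IH] x /=; first by case.
move=> [e [d [y [h -> hy]]]]; have [e0 d0] : e = 0 /\ d = 0 by lia.
by move: hy; rewrite e0 d0 => /IH ->.
Qed.

Definition splits (a : nat) (A : seq nat) (d x e : nat) : Prop :=
  exists d' y, [/\ d = e + d', x = e * a + y & sum_of A d' y].

(** One number can be a sum of [d] generators in several ways; the largest
    possible multiplicity of [a] is a canonical choice, which stands for the
    exponent of [a] in a monomial. *)
Definition topexp (a : nat) (A : seq nat) (d x : nat) : nat :=
  \max_(e < d.+1 | `[< splits a A d x e >]) e.

Lemma topexp_ge a A d x e : splits a A d x e -> e <= topexp a A d x.
Proof.
move=> hs; have ed : e < d.+1 by case: hs => d' [y [-> _ _]]; lia.
by apply: (bigmax_sup (Ordinal ed)) => //; apply/asboolP.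
Qed.

Lemma topexp_splits a A d x :
  sum_of (a :: A) d x -> splits a A d x (topexp a A d x).
Proof.
move=> [e hs]; have hs' : splits a A d x e by [].
have ed : e < d.+1 by case: hs => d' [y [-> _ _]]; lia.
pose P (i : 'I_d.+1) := `[< splits a A d x i >].
have Pe : P (Ordinal ed) by apply/asboolP.
rewrite /topexp (@bigop.bigmax_eq_arg _ (Ordinal ed) P) //.
by case: arg_maxnP => // i /asboolP.
Qed.

Lemma topexp_eq a A d x e :
  splits a A d x e -> (forall e', splits a A d x e' -> e' <= e) ->
  topexp a A d x = e.
Proof.
move=> hs hmax; apply/eqP; rewrite eqn_leq topexp_ge // andbT.
by apply/hmax/topexp_splits; exists e.
Qed.

Lemma splitsD1 a A d x e b :
  b \in A -> splits a A d x e -> splits a A d.+1 (x + b) e.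
Proof.
move=> bA [d' [y [-> -> hy]]]; exists d'.+1, (y + b); split; [lia | lia |].
by rewrite -addn1; apply: sum_ofD => //; apply: sum_of1.
Qed.

Lemma splitsDa a A d x e :
  splits a A d x e -> splits a A d.+1 (x + a) e.+1.
Proof. by move=> [d' [y [-> -> hy]]]; exists d', y; split=> //; lia. Qed.

(** Maximality passes to summands: a larger multiplicity of [a] in [x] would
    also be available in [x + b]. *)
Lemma topexp_subr a A d x b e :
  b \in A -> topexp a A d.+1 (x + b) = e -> splits a A d x e ->
  topexp a A d x = e.
Proof.
move=> bA <- hs; apply: topexp_eq => // e' /(splitsD1 _ _ _ _ _ _ bA).
exact: topexp_ge.
Qed.

Lemma topexp_suba a A d x e :
  topexp a A d.+1 (x + a) = e.+1 -> splits a A d x e ->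
  topexp a A d x = e.
Proof.
move=> te hs; apply: topexp_eq => // e' /splitsDa /topexp_ge.
by rewrite te.
Qed.

(** * Growth of shadows *)

Lemma sum_count_le (f : nat -> nat) (Z : seq nat) n :
  \sum_(i < n) count (fun z => f z == i) Z <= size Z.
Proof.
elim: Z => [|z Z IH] /=; first by rewrite big1.
rewrite big_split /= -addn1 addnC; apply: leq_add IH _.
case: (ltnP (f z) n) => fz.
  by rewrite (bigD1 (Ordinal fz)) //= eqxx big1 // => i;
     rewrite -val_eqE /= eq_sym => /negbTE ->.
by rewrite big1 // => i _; case: eqP => // fi; have := ltn_ord i; lia.
Qed.

Lemma sum_count_eq (f : nat -> nat) (Z : seq nat) n :
  {in Z, forall z, f z < n} ->
  \sum_(i < n) count (fun z => f z == i) Z = size Z.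
Proof.
elim: Z => [|z Z IH] /= hZ; first by rewrite big1.
rewrite big_split /= IH => [|y yZ]; last by apply: hZ; rewrite inE yZ orbT.
rewrite (bigD1 (Ordinal (hZ z (mem_head _ _)))) //= eqxx big1 // => i.
by rewrite -val_eqE /= eq_sym => /negbTE ->.
Qed.

Lemma leq_sum_range (u v : nat -> nat) m n :
  (forall i, m <= i < n -> u i <= v i) ->
  \sum_(m <= i < n) u i <= \sum_(m <= i < n) v i.
Proof.
move=> uv; rewrite big_nat_cond [leqRHS]big_nat_cond.
by apply: leq_sum => i /andP[/uv].
Qed.

(** Where [u] vanishes at [j], the terms beyond [j] can each be shifted down by
    one without losing anything. *)
Lemma shifted_sum_le (u v : nat -> nat) n j :
  j <= n -> u j = 0 -> (forall i, i < j -> u i <= v i) ->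
  (forall i, j <= i < n -> u i.+1 <= v i) ->
  \sum_(i < n.+1) u i <= \sum_(i < n) v i.
Proof.
move=> jn uj lo hi; rewrite -!(big_mkord xpredT).
rewrite (@big_cat_nat _ _ _ j) //=; last exact: leqW.
rewrite [leqRHS](@big_cat_nat _ _ _ j) //=.
apply: leq_add; first by apply: leq_sum_range => i /andP[_ /lo].
rewrite big_ltn ?ltnS // uj add0n big_add1 /=.
exact: leq_sum_range.
Qed.

Lemma sum_pos_ge (u : nat -> nat) j :
  (forall i, i < j -> 0 < u i) -> j <= \sum_(i < j) u i.
Proof.
elim: j => [|j IH] hu; first by [].
rewrite big_ord_recr /= -addn1; apply: leq_add; last exact: hu.
by apply: IH => i ij; apply: hu; lia.
Qed.

(** Induction on the generators.  Sort [X] by the exponent [i] of the first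
    generator [a] into classes [Xi i], and the shadow [Z] likewise into [Zi i].
    The class [Zi i] receives both the shadow of [Xi i] with respect to the
    other generators and the translate of [Xi i.+1] by [- a].  As [X] has at
    most [d.+1] elements and there are [d.+2] possible exponents, some class is
    empty; let [j] be the first such exponent.  Below [j] the preceding classes
    are nonempty, which leaves at most [d.+1 - i] elements for [Xi i], and the
    induction hypothesis gives [size (Xi i) <= size (Zi i)].  From [j] on, the
    translates give [size (Xi i.+1) <= size (Zi i)], and nothing is lost at [j]
    itself. *)
Lemma shadow_size A d (X Z : seq nat) :
  uniq X -> size X <= d.+1 -> {in X, forall x, sum_of A d.+1 x} ->
  (forall t a, a \in A -> sum_of A d t -> t + a \in X -> t \in Z) ->
  size X <= size Z.
Proof.
elim: A d X Z => [|a A IH] d X Z uX sX hX hZ.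
  by case: X {uX sX hZ} hX => // x X /(_ x (mem_head _ _)) [].
pose f := topexp a A d.+1; pose f' := topexp a A d.
pose Xi i := [seq x <- X | f x == i]; pose Zi i := [seq z <- Z | f' z == i].
have Xsplit i x : x \in Xi i ->
    exists2 y, x = i * a + y & i <= d.+1 /\ sum_of A (d.+1 - i) y.
  rewrite mem_filter => /andP[/eqP fx /hX /topexp_splits].
  rewrite -/(f x) fx => -[d' [y [dE xE hy]]]; exists y => //; split; first lia.
  by have -> : d.+1 - i = d' by lia.
have sumX : \sum_(i < d.+2) size (Xi i) = size X.
  rewrite -(@sum_count_eq f X d.+2).
    by apply: eq_bigr => i _; rewrite size_filter.
  move=> x xX; have [] := Xsplit (f x) x; first by rewrite mem_filter eqxx.
  by move=> y _ [].
have sumZ : \sum_(i < d.+1) size (Zi i) <= size Z.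
  apply: leq_trans (sum_count_le f' Z d.+1).
  by apply: leq_sum => i _; rewrite size_filter.
have [j0 j0d Xj0] : exists2 j, j <= d.+1 & size (Xi j) == 0.
  apply: contrapT => no; have := @sum_pos_ge (fun i => size (Xi i)) d.+2.
  rewrite sumX => H; suff: d.+2 <= size X by lia.
  by apply: H => i id; rewrite lt0n; apply/negP => Xi0; apply: no; exists i.
have exj : exists j, size (Xi j) == 0 by exists j0.
case: (ex_minnP exj) => j /eqP Xj minj.
have jd : j <= d.+1 by apply: leq_trans (minj _ Xj0) j0d.
rewrite -sumX; apply: leq_trans sumZ.
apply: (@shifted_sum_le (fun i => size (Xi i)) (fun i => size (Zi i)) _ j) => //.
- move=> i ij; rewrite -(size_map (subn^~ (i * a)) (Xi i)).
  rewrite -(size_map (subn^~ (i * a)) (Zi i)).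
  have id : i <= d by lia.
  have dE : (d - i).+1 = d.+1 - i by lia.
  apply: (IH (d - i)).
  + rewrite map_inj_in_uniq ?filter_uniq //.
    by move=> x x' /Xsplit[y -> _] /Xsplit[y' -> _]; lia.
  + (* The nonempty classes below [i] use up at least [i] elements. *)
    rewrite size_map dE.
    have : \sum_(k < i.+1) size (Xi k) <= size X.
      rewrite -sumX -!(big_mkord xpredT (fun k => size (Xi k))).
      by rewrite [leqRHS](@big_cat_nat _ _ _ i.+1) ?leq_addr //; lia.
    rewrite big_ord_recr /=.
    have : i <= \sum_(k < i) size (Xi k).
      apply: (@sum_pos_ge (fun k => size (Xi k))) => k ki.
      by rewrite lt0n; apply/negP => /minj; lia.
    move=> lo hi; rewrite leq_subRL; last lia.
    by apply: leq_trans (leq_trans hi sX); apply: leq_add lo _.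
  + move=> _ /mapP[x /Xsplit[y -> [_ hy]] ->]; rewrite dE addKn; exact: hy.
  + move=> t b bA ht /mapP[x xXi].
    have [y xE _] := Xsplit _ _ xXi; rewrite xE addKn => tby.
    have st : splits a A d (i * a + t) i.
      by exists (d - i), t; split=> //; lia.
    have xE' : x = i * a + t + b by lia.
    move: xXi; rewrite mem_filter xE' => /andP[/eqP fx xX].
    apply/mapP; exists (i * a + t); last by rewrite addKn.
    rewrite mem_filter; apply/andP; split.
      by apply/eqP; apply: topexp_subr fx st.
    by apply: (hZ _ b) => //; [rewrite inE bA orbT | exists i].
- move=> i /andP[_ id]; rewrite -(size_map (subn^~ a) (Xi i.+1)).
  apply: uniq_leq_size.
    rewrite map_inj_in_uniq ?filter_uniq //.
    by move=> x x' /Xsplit[y -> _] /Xsplit[y' -> _]; lia.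
  move=> _ /mapP[x xXi ->].
  have [y xE [_ hy]] := Xsplit _ _ xXi.
  have st : splits a A d (x - a) i.
    by exists (d.+1 - i.+1), y; split=> //; lia.
  have xE' : x = x - a + a by lia.
  move: xXi; rewrite mem_filter {1 2}xE' => /andP[/eqP fx xX].
  rewrite mem_filter; apply/andP; split.
    by apply/eqP; apply: topexp_suba fx st.
  by apply: (hZ _ a) => //; [rewrite mem_head | exists i].
Qed.

(** * The filtration by the powers of the maximal ideal *)

Lemma hfoldS {S : set nat} k x : subsemigroup0 S ->
  hfold S k.+1 x <-> exists t m, [/\ hfold S k t, maxideal S m & x = t + m].
Proof.
move=> [S0 SD]; split.
  move=> [m hm ->]; rewrite big_ord_recr /=.
  exists (\sum_(i < k) m (widen_ord (leqnSn k) i)), (m ord_max); split=> //.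
  case: k m hm => [|k] m hm; first by rewrite big_ord0.
  by exists (fun i => m (widen_ord (leqnSn _) i)).
move=> [t [m [ht hm ->]]]; case: k ht => [|k] /=.
  move=> St; exists (fun=> t + m); last by rewrite big_ord1.
  move=> _; case: hm => Sm m0; split; first exact: SD.
  by move=> /= ?; apply: m0 => /=; lia.
move=> [n hn ->].
exists (fun i : 'I_k.+2 => if unlift ord_max i is Some i' then n i' else m).
  by move=> i; case: (unlift _ _).
rewrite [RHS]big_ord_recr /= unlift_none; congr (_ + _).
apply: eq_bigr => i _.
have -> : widen_ord (leqnSn k.+1) i = lift ord_max i.
  by apply: val_inj; rewrite /= /bump leqNgt ltn_ord.
by rewrite liftK.
Qed.

Section Filtration.

Context {S : set nat}.
Hypothesis hS : subsemigroup0 S.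

Lemma hfoldD k t m : hfold S k t -> maxideal S m -> hfold S k.+1 (t + m).
Proof. by move=> ht hm; apply/(hfoldS _ _ hS); exists t, m. Qed.

Lemma hfold_anti k l : k <= l -> hfold S l `<=` hfold S k.
Proof.
have step j : hfold S j.+1 `<=` hfold S j.
  elim: j => [|j IH] x /(hfoldS _ _ hS) [t [m [ht hm ->]]].
    by apply: hS.2 => //; case: hm.
  exact: hfoldD _ _ _ (IH _ ht) hm.
move=> /subnK <-; elim: (l - k) => [|i IH] x //; rewrite addSn.
by move=> /step /IH.
Qed.

Lemma hfold_ge k x : hfold S k x -> k <= x.
Proof.
elim: k x => [|k IH] x // /(hfoldS _ _ hS) [t [m [/IH kt [_ /= m0] ->]]].
by move: m0 => /eqP; lia.
Qed.

Lemma hfold_sum_of A d x :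
  {in A, forall a, maxideal S a} -> sum_of A d x -> hfold S d x.
Proof.
elim: A d x => [|a A IH] d x hA /=; first by move=> [-> ->]; case: hS.
move=> [e [d' [y [-> -> hy]]]].
have hy' : hfold S d' y.
  by apply: IH hy => b bA; apply: hA; rewrite inE bA orbT.
elim: e => [|e IHe] //.
have -> : e.+1 * a + y = e * a + y + a by lia.
by apply: hfoldD => //; apply: hA; rewrite mem_head.
Qed.

(** * Nonzero monomials modulo the smallest generator *)

(** The set [C_k].  If [x - g_1] lay in [kM], then [x] would lie in [(k+1)M], so
    for [k >= 1] excluding [x - g_1] from all of [(k-1)M] is no stronger than
    excluding it from [(k-1)M] minus [kM]. *)
Definition tangent (g1 k x : nat) : Prop :=
  [/\ hfold S k x, ~ hfold S k.+1 x
    & forall u, x = u + g1 -> ~ hfold S k.-1 u].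

Lemma tangent_sub_Cset g1 k : tangent g1 k `<=` Cset S g1 k.
Proof.
move=> x [hx nhx hu]; split=> //; move=> [g1x [hxg _]].
by apply: (hu (x - g1)) => //; rewrite subnK.
Qed.

Lemma tangent_summand g1 k t m :
  maxideal S m -> hfold S k.+1 t -> tangent g1 k.+2 (t + m) ->
  tangent g1 k.+1 t.
Proof.
move=> hm ht [_ nhx hu]; split=> // [ht'|u tE hu'].
  by apply: nhx; apply: hfoldD.
by apply: (hu (u + m)); [lia | apply: hfoldD].
Qed.

Lemma tangentD g1 k l x m :
  tangent g1 k x -> maxideal S m -> tangent g1 l (x + m) -> k < l.
Proof.
move=> [hx _ _] hm [_ nhx _]; rewrite ltnNge; apply/negP => lk.
by apply/nhx/(@hfold_anti l.+1 k.+1) => //; apply: hfoldD.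
Qed.

(** The degree [k] is the order of [s + g1].  It exists because an element of
    [kM] is at least [k]. *)
Lemma tangent_of_jump g1 h s :
  hfold S h.+1 (s + g1) -> ~ hfold S h s ->
  exists k, h < k /\ tangent g1 k (s + g1).
Proof.
move=> hs ns; pose P k := `[< hfold S k (s + g1) >].
have exP : exists k, P k by exists h.+1; apply/asboolP.
have ubP k : P k -> k <= s + g1 by move=> /asboolP/hfold_ge.
case: (ex_maxnP exP ubP) => k /asboolP hk maxk; exists k.
have hk' : h < k by apply: maxk; apply/asboolP.
split=> //; split=> // [/asboolP/maxk|u /addIn <- hu]; first by rewrite ltnn.
by apply: ns; apply: hfold_anti hu; lia.
Qed.

Context {A : seq nat}.
Hypothesis AM : {in A, forall a, maxideal S a}.
Hypothesis A_gen : forall x, S x -> exists d, sum_of A d x.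

(** An element of [M] may need several generators, hence an inequality; it is an
    equality on elements of order exactly [k], as the next lemma shows. *)
Lemma sum_of_hfold k x : hfold S k x -> exists2 l, k <= l & sum_of A l x.
Proof.
elim: k x => [|k IH] x; first by move=> /A_gen[d hd]; exists d.
move=> /(hfoldS _ _ hS) [t [m [/IH[l kl ht] [/A_gen[d hm] /= m0] ->]]].
exists (l + d); last exact: sum_ofD.
by case: d hm => [/sum_of_deg0 //|d _]; lia.
Qed.

Lemma sum_of_tangent g1 k x : tangent g1 k x -> sum_of A k x.
Proof.
move=> [/sum_of_hfold[l kl hl] nhx _].
suff -> : k = l by [].
apply/eqP; rewrite eqn_leq kl leqNgt; apply/negP => lk.
by apply/nhx/(hfold_anti _ _ lk)/(hfold_sum_of A).
Qed.

(** * Descent to a single degree *)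

(** The elements [T] of top degree are traded for [size T] elements of their
    shadow.  A shadow element [t] cannot be one of the remaining elements [L],
    nor divisible by one, since it divides an element of [T]; and it divides no
    element of [L] or of the shadow, because divisibility strictly increases
    the degree.  [n] bounds how far the degrees exceed [h.+1]. *)
Lemma antichain_descent g1 h n (X : seq nat) :
  uniq X -> size X <= h.+2 ->
  {in X, forall x, exists k, h < k <= h.+1 + n /\ tangent g1 k x} ->
  {in X, forall x m, maxideal S m -> x + m \notin X} ->
  exists Z, [/\ uniq Z, size Z = size X & {in Z, forall z, tangent g1 h.+1 z}].
Proof.
elim: n X => [|n IH] X uX sX hX aX.
  exists X; split=> // x /hX[k [hk]].
  by have -> : k = h.+1 by lia.
pose top x := `[< tangent g1 (h + n).+2 x >].
pose T := [seq x <- X | top x]; pose L := [seq x <- X | ~~ top x].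
have sTL : size T + size L = size X.
  by rewrite !size_filter count_predC.
(* [Y] lists the shadow of [T]; as only nonzero monomials are kept, it already
   lies in the next lower degree. *)
pose sh x t := `[< tangent g1 (h + n).+1 t /\ exists2 a, a \in A & t + a = x >].
pose Y := undup (flatten [seq [seq t <- iota 0 x.+1 | sh x t] | x <- T]).
have YP t : t \in Y -> tangent g1 (h + n).+1 t /\
    exists2 a, a \in A & t + a \in T.
  rewrite mem_undup => /flatten_mapP[x xT]; rewrite mem_filter.
  by move=> /andP[/asboolP[ht [a aA tax]] _]; split=> //; exists a; rewrite ?tax.
have TY : size T <= size Y.
  apply: (@shadow_size A (h + n).+1); rewrite ?filter_uniq //.
  - by lia.
  - by move=> x; rewrite mem_filter => /andP[/asboolP/sum_of_tangent].
  - move=> t a aA ht taT; rewrite mem_undup; apply/flatten_mapP.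
    exists (t + a) => //; rewrite mem_filter mem_iota; apply/andP; split; last lia.
    apply/asboolP; split; last by exists a.
    move: taT; rewrite mem_filter => /andP[/asboolP hta _].
    by apply: tangent_summand hta; [exact: AM | exact: hfold_sum_of ht].
pose Y' := take (size T) Y.
have sY' : size Y' = size T by rewrite size_take_min; apply/minn_idPl.
have Y'P t : t \in Y' -> tangent g1 (h + n).+1 t /\
    exists2 a, a \in A & t + a \in X.
  move=> /mem_take/YP[ht [a aA]]; rewrite mem_filter => /andP[_ taX].
  by split=> //; exists a.
have LX x : x \in L -> x \in X by rewrite mem_filter => /andP[].
have hL x : x \in L -> exists k, h < k <= h.+1 + n /\ tangent g1 k x.
  rewrite mem_filter => /andP[/asboolP ntx /hX[k [hk hx]]]; exists k; split=> //.
  suff : k != (h + n).+2 by lia.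
  by apply/eqP => kE; apply: ntx; rewrite -kE.
have [||||Z [uZ sZ hZ]] := IH (L ++ Y').
- rewrite cat_uniq filter_uniq // take_uniq ?undup_uniq // andbT /=.
  apply/hasPn => t /Y'P[_ [a aA taX]]; apply/negP => /LX tX.
  by have := aX _ tX _ (AM _ aA); rewrite taX.
- by rewrite size_cat sY' addnC sTL.
- move=> x; rewrite mem_cat => /orP[/hL //|/Y'P[hx _]].
  by exists (h + n).+1; split=> //; lia.
- move=> x; rewrite mem_cat => /orP[xL|xY] m hm; apply/negP;
    rewrite mem_cat => /orP[xmL|xmY].
  + by have := aX _ (LX _ xL) _ hm; rewrite LX.
  + have [_ [a aA]] := Y'P _ xmY; rewrite -addnA; apply/negP.
    apply: aX (LX _ xL) _ _; have [[Sm m0] [Sa a0]] := (hm, AM _ aA).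
    by split; [exact: hS.2 | move=> /= ma; apply: m0 => /=; lia].
  + have [k [hk hxm]] := hL _ xmL; have [hx _] := Y'P _ xY.
    by have := tangentD _ _ _ _ _ hx hm hxm; lia.
  + have [hx _] := Y'P _ xY; have [hxm _] := Y'P _ xmY.
    by have := tangentD _ _ _ _ _ hx hm hxm; rewrite ltnn.
by exists Z; split=> //; rewrite sZ size_cat sY' addnC.
Qed.

End Filtration.

(** * Positive generators and finite sets as lists *)

Lemma sum_of_span (g : seq nat) (c : nat -> nat) :
  exists d, sum_of [seq a <- g | 0 < a] d (\sum_(x <- g) c x * x).
Proof.
elim: g => [|a g [d IH]]; first by exists 0; rewrite big_nil.
rewrite big_cons; case: a => [|a] /=; first by exists d; rewrite muln0.
by exists (c a.+1 + d), (c a.+1), d, (\sum_(x <- g) c x * x).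
Qed.

Lemma span_mem (g : seq nat) a : uniq g -> a \in g -> span g a.
Proof.
move=> ug ag; exists (fun x => (x == a) : nat).
rewrite (bigD1_seq a) //= eqxx mul1n big1 ?addn0 // => x /negbTE ->.
by rewrite mul0n.
Qed.

Lemma card_le_seq (D : set nat) n :
  D #<= `I_n ->
  exists L : seq nat, [/\ uniq L, size L <= n & forall x, x \in L <-> D x].
Proof.
move=> /[dup] Dn /card_le_finite /(_ (finite_II n)) /finite_seqP[s Ds].
exists (undup s); split; first exact: undup_uniq.
  move: Dn => /pcard_leP[f]; rewrite -(size_iota 0 n) -(size_map f).
  apply: uniq_leq_size.
    rewrite map_inj_in_uniq ?undup_uniq // => x y; rewrite !mem_undup => xs ys.
    by apply: 'inj_f; rewrite inE Ds.
  move=> _ /mapP[x xs ->]; rewrite mem_iota /=.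
  by apply: 'funS_f; rewrite Ds /= -mem_undup.
by move=> x; rewrite mem_undup Ds.
Qed.

Theorem theorem2p3 (S : set nat) (g : seq nat) (h : nat)
    (hS : numerical_semigroup S g) (h_ge2 : 2 <= h)
    (hD : Dset S (nth 0 g 0) h #<= `I_h.+1) :
  exists psi : nat -> nat,
    set_fun (Dset S (nth 0 g 0) h) (Cset S (nth 0 g 0) h) psi /\
    set_inj (Dset S (nth 0 g 0) h) psi.
Proof.
case: hS => S0 [/(sorted_uniq ltn_trans ltnn) ug gS _] _.
case: h h_ge2 hD => [//|h] _; set g1 := nth 0 g 0 => hD.
have [L [uL sL LP]] := card_le_seq _ _ hD.
pose A := [seq a <- g | 0 < a].
have AM : {in A, forall a, maxideal S a}.
  move=> a; rewrite mem_filter => /andP[a0 ag]; split.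
    by rewrite -gS; apply: span_mem.
  by move=> /= aE; rewrite aE in a0.
have A_gen x : S x -> exists d, sum_of A d x.
  by rewrite -gS => -[c ->]; apply: sum_of_span.
have LT x : x \in L -> exists k, h.+1 < k /\ tangent (S := S) g1 k (x + g1).
  by move=> /LP[[_ nx] hx]; apply: tangent_of_jump.
have [||||Z [uZ sZ hZ]] := antichain_descent S0 AM A_gen g1 h
    (\max_(x <- L) (x + g1)) [seq x + g1 | x <- L].
(* The maximum bounds all the degrees, since elements of [kM] are at least [k]. *)
- by rewrite map_inj_uniq // => x y /addIn.
- by rewrite size_map.
- move=> _ /mapP[x xL ->]; have [k [hk hx]] := LT _ xL.
  exists k; split=> //; apply/andP; split; first lia.
  have [/(hfold_ge S0) kx _ _] := hx.
  apply: leq_trans kx _; apply: leq_trans (leq_addl _ _).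
  by apply: (leq_bigmax_seq (F := fun x => x + g1)).
- move=> _ /mapP[x xL ->] m hm; apply/negP => /mapP[y yL yE].
  (* The antichain property: [y = x + m] would lie in [hM]. *)
  have [[[hx _] _] [[_ ny] _]] := ((LP x).1 xL, (LP y).1 yL).
  apply: ny; have <- : x + m = y by lia.
  exact: hfoldD.
rewrite size_map in sZ.
exists (fun x => nth 0 Z (index x L)); split.
  move=> x /LP xL; apply: tangent_sub_Cset; apply: hZ.
  by rewrite mem_nth // sZ index_mem.
move=> x y; rewrite !inE => /LP xL /LP yL /eqP.
rewrite nth_uniq ?sZ ?index_mem // => /eqP xy.
by rewrite -(nth_index 0 xL) xy nth_index.
Qed.
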